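(* Let $R$ be a commutative unital ring, $\Gamma$ a discrete abelian group, $\mathcal G$ a $\Gamma$-graded ample groupoid and $x\in\mathcal G^{(0)}$. If $N=\bigoplus_{\gamma\in\Gamma}N_\gamma$ is a graded $R\mathcal G_x$-module, then $\mathrm{Ind}_x(N)=RL_x\otimes_{R\mathcal G_x}N$ is a graded $A_R(\mathcal G)$-module. Moreover, $\mathrm{Ind}_x$ is a functor from the category of graded $R\mathcal G_x$-modules to the category of graded $A_R(\mathcal G)$-modules (with graded homomorphisms), and it commutes with the shift functors $\mathcal T_\alpha$ on graded $R\mathcal G_x$-modules and on graded $A_R(\mathcal G)$-modules, for all $\alpha\in\Gamma$.
   Context: Groupoids. For a groupoid $\mathcal G$ with unit space $\mathcal G^{(0)}$, $d(g)=g^{-1}g$, $c(g)=gg^{-1}$, and $gh$ is defined iff $d(g)=c(h)$. For $x\in\mathcal G^{(0)}$: $L_x=d^{-1}(x)$ and $\mathcal G_x=\{g: d(g)=c(g)=x\}$ is the isotropy group. An open bisection is an open $U\subseteq\mathcal G$ such that $d|_U$, $c|_U$ are homeomorphisms onto open subsets of $\mathcal G^{(0)}$. A topological groupoid $\mathcal G$ is ample if $d$ is a local homeomorphism, $\mathcal G^{(0)}$ is Hausdorff, and compact open bisections form a basis of the topology. $\mathcal G$ is $\Gamma$-graded if there is a continuous $\kappa:\mathcal G\to\Gamma$ with $\kappa(gh)=\kappa(g)\kappa(h)$ for composable $g,h$; $\mathcal G_\gamma=\kappa^{-1}(\gamma)$. $A_R(\mathcal G)$ (Steinberg algebra) is the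 $R$-span in $R^{\mathcal G}$ of characteristic functions $\mathbf 1_U$ of compact open bisections, with product $f*g(x)=\sum_{d(y)=d(x)}f(xy^{-1})g(y)$; it is $\Gamma$-graded with $A_R(\mathcal G)_\gamma$ spanned by the $\mathbf 1_U$ with $U\subseteq\mathcal G_\gamma$. $R\mathcal G_x$ is $\Gamma$-graded with $\gamma$-component having basis $\mathcal G_x\cap\mathcal G_\gamma$. $RL_x$ is the free $R$-module on $L_x$, an $A_R(\mathcal G)$-$R\mathcal G_x$-bimodule with right action by composition and left action $ft=\sum_{d(y)=c(t)}f(y)\,yt$ ($t\in L_x$), graded with $\gamma$-component spanned by $L_x\cap\mathcal G_\gamma$. Modules are left and unital ($AM=M$); a graded module is $M=\bigoplus_\gamma M_\gamma$ with $A_\delta M_\gamma\subseteq M_{\delta\gamma}$; graded homomorphisms preserve degrees. $\mathcal T_\alpha(M)=M(\alpha)$ where $M(\alpha)_\gamma=M_{\gamma\alpha}$. The $\gamma$-component of $\mathrm{Ind}_x(N)$ is the $R$-span of $t\otimes n$ with $t\in L_x\cap\mathcal G_\alpha$, $n\in N_\beta$, $\alpha\beta=\gamma$. *)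

(* Defs.v *)
From HB Require Import structures.
From mathcomp Require Import all_boot all_algebra.
From mathcomp Require Import all_classical topology numfun.
From mathcomp Require Import finmap monalg ring_quotient.

Set Implicit Arguments.
Unset Strict Implicit.
Unset Printing Implicit Defensive.

Import GRing.Theory.
Local Open Scope classical_set_scope.
Local Open Scope ring_scope.
Local Open Scope quotient_scope.

(* The grading group is an abelian group in additive notation (zmodType):
   the product alpha beta is written alpha + beta. *)

Definition is_subgroup (V : zmodType) (H : set V) : Prop :=
  H 0 /\ forall u v, H u -> H v -> H (u - v).

(* In an R-module, the R-span of a family (e_i) is the additive span of the
   multiples r e_i with r in R; this is how R-spans are written below. *)
Definition addspan (V : zmodType) (S : set V) : set V :=
  smallest (@is_subgroup V) S.

Lemma addspan_subgroup (V : zmodType) (S : set V) : is_subgroup (addspan S).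
Proof.
split=> [H [[]]|u v uS vS H HS] //.
by case: (HS) => -[_ HB] _; apply: HB; [exact: uS | exact: vS].
Qed.

Lemma sub_addspan (V : zmodType) (S : set V) : S `<=` addspan S.
Proof. by move=> u Su H [_]; apply. Qed.

(* Rings need not be unital.  Both records carry data only: the axioms of a
   graded module are the predicate graded_module, and those of a graded ring
   are not needed to state them. *)
Record gringData (Gam : zmodType) := GRingData {
  gr_car :> zmodType;
  gr_mul : gr_car -> gr_car -> gr_car;
  gr_comp : Gam -> set gr_car }.

Record gmodData (Gam : zmodType) (A : gringData Gam) := GModData {
  gm_car :> zmodType;
  gm_act : A -> gm_car -> gm_car;
  gm_comp : Gam -> set gm_car }.

Record graded_module (Gam : zmodType) (A : gringData Gam) (M : gmodData A)
  : Prop := {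
  gm_actDl : forall (a b : A) (m : M),
    gm_act (a + b) m = gm_act a m + gm_act b m;
  gm_actDr : forall (a : A) (m n : M),
    gm_act a (m + n) = gm_act a m + gm_act a n;
  gm_actA : forall (a b : A) (m : M),
    gm_act (gr_mul a b) m = gm_act a (gm_act b m);
  gm_unital : addspan [set m : M | exists a n, m = gm_act a n] = setT;
  gm_comp_subgroup : forall g, is_subgroup (@gm_comp _ _ M g);
  gm_direct_sum : forall m : M, exists! f : Gam -> M,
    [/\ forall g, gm_comp g (f g),
        finite_set [set g | f g <> 0]
      & m = \sum_(g \in [set: Gam]) f g];
  gm_act_comp : forall (d g : Gam) (a : A) (m : M),
    gr_comp d a -> gm_comp g m -> gm_comp (d + g) (gm_act a m) }.

Record graded_hom (Gam : zmodType) (A : gringData Gam) (M N : gmodData A)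
    (f : M -> N) : Prop := {
  ghomD : forall m n : M, f (m + n) = f m + f n;
  ghom_act : forall (a : A) (m : M), f (gm_act a m) = gm_act a (f m);
  ghom_comp : forall (g : Gam) (m : M), gm_comp g m -> gm_comp g (f m) }.

(* F and Fmap are defined on all data; the functor laws concern only graded
   modules and graded homomorphisms. *)
Record graded_functor (Gam : zmodType) (A B : gringData Gam)
    (F : gmodData A -> gmodData B)
    (Fmap : forall M N : gmodData A, (M -> N) -> F M -> F N) : Prop := {
  gfunctor_ob : forall M : gmodData A, graded_module M -> graded_module (F M);
  gfunctor_hom : forall (M N : gmodData A) (f : M -> N),
    graded_module M -> graded_module N -> graded_hom f ->
    graded_hom (Fmap M N f);
  gfunctor_id : forall M : gmodData A, graded_module M ->
    Fmap M M (fun m => m) = (fun m => m);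
  gfunctor_comp : forall (M N P : gmodData A) (f : M -> N) (h : N -> P),
    graded_module M -> graded_module N -> graded_module P ->
    graded_hom f -> graded_hom h ->
    Fmap M P (fun m => h (f m)) = (fun m => Fmap N P h (Fmap M N f m)) }.

(* The shift functor T_alpha : M(alpha)_g = M_(g alpha). *)
Definition shift (Gam : zmodType) (A : gringData Gam) (alpha : Gam)
    (M : gmodData A) : gmodData A :=
  {| gm_car := gm_car M;
     gm_act := @gm_act _ _ M;
     gm_comp := fun g => @gm_comp _ _ M (g + alpha) |}.

Definition shift_map (Gam : zmodType) (A : gringData Gam) (alpha : Gam)
    (M N : gmodData A) (f : M -> N) : shift alpha M -> shift alpha N := f.
Arguments shift_map {Gam A} alpha {M N} f.

Section TensorProduct.
Context (B U N : zmodType) (ract : U -> B -> U) (lact : B -> N -> N).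

Local Notation free := {malg int[(U * N)%type]}.
Local Notation gen u n := (mkmalgU (u, n) (1 : int)).

Definition tens_relators : set free :=
  [set z | exists u u' n, z = gen (u + u') n - gen u n - gen u' n] `|`
  [set z | exists u n n', z = gen u (n + n') - gen u n - gen u n'] `|`
  [set z | exists u b n, z = gen (ract u b) n - gen u (lact b n)].

Definition tens_null : {pred free} := fun z => `[< addspan tens_relators z >].

Fact tens_null_zmod_closed : zmod_closed tens_null.
Proof.
have [H0 HB] := addspan_subgroup tens_relators.
split=> [|u v]; rewrite !unfold_in; first exact/asboolP.
move=> /asboolP uH /asboolP vH; apply/asboolP; exact: HB.
Qed.

HB.instance Definition _ :=
  GRing.isZmodClosed.Build free tens_null tens_null_zmod_closed.

Definition tens : zmodType := Quotient.quot tens_null.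

Definition tmk (u : U) (n : N) : tens := \pi_(Quotient.quot tens_null) (gen u n).

(* The additive map u (x) n |-> f u n, for f biadditive and balanced. *)
Definition tens_lift (T : zmodType) (f : U -> N -> T) (q : tens) : T :=
  let z := repr (q : Quotient.quot tens_null) in
  \sum_(p <- msupp z) f p.1 p.2 *~ z@_p.

Section Lift.
Context (T : zmodType) (f : U -> N -> T).
Hypotheses (fDl : forall u u' n, f (u + u') n = f u n + f u' n)
  (fDr : forall u n n', f u (n + n') = f u n + f u n')
  (f_bal : forall u b n, f (ract u b) n = f u (lact b n)).

Let F (z : free) : T := \sum_(p <- msupp z) f p.1 p.2 *~ z@_p.

Let FE (d : {fset (U * N)%type}) (z : free) : (msupp z `<=` d)%fset ->
  F z = \sum_(p <- d) f p.1 p.2 *~ z@_p.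
Proof.
move=> zd; rewrite /F; apply: big_fset_incl => // p _ pz.
by rewrite mcoeff_outdom // mulr0z.
Qed.

Let FB (z w : free) : F (z - w) = F z - F w.
Proof.
pose d := (msupp z `|` msupp w `|` msupp (z - w))%fset.
have zd : (msupp z `<=` d)%fset by rewrite /d -fsetUA; exact: fsubsetUl.
have wd : (msupp w `<=` d)%fset by rewrite /d fsetUAC; exact: fsubsetUr.
have zwd : (msupp (z - w) `<=` d)%fset by exact: fsubsetUr.
rewrite (FE zd) (FE wd) (FE zwd).
rewrite -sumrB; apply: eq_bigr => p _.
by rewrite mcoeffB mulrzBr.
Qed.

Let Fgen u n : F (gen u n) = f u n.
Proof. by rewrite (FE msuppU_le) big_seq_fset1 mcoeffUU. Qed.

Let F_null z : addspan tens_relators z -> F z = 0.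
Proof.
move=> /(_ [set w | F w = 0]); apply.
split=> [|_ [[|]|] [u [u' [n ->]]]] /=; last first.
- by rewrite FB !Fgen f_bal subrr.
- by rewrite !FB !Fgen fDr addrAC addrK subrr.
- by rewrite !FB !Fgen fDl addrAC addrK subrr.
split=> [|z1 z2 /= h1 h2]; last by rewrite FB h1 h2 subrr.
by have := FB 0 0; rewrite !subrr.
Qed.

Let tens_liftE z : tens_lift f (\pi_(Quotient.quot tens_null) z) = F z.
Proof.
apply/eqP; rewrite -subr_eq0 -FB; apply/eqP/F_null/asboolP.
by have := Quotient.idealrBE tens_null
  (repr (\pi_(Quotient.quot tens_null) z)) z; rewrite reprK eqxx.
Qed.

Lemma tens_lift_tmk u n : tens_lift f (tmk u n) = f u n.
Proof. by rewrite tens_liftE Fgen. Qed.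

Lemma tens_liftB q q' : tens_lift f (q - q') = tens_lift f q - tens_lift f q'.
Proof.
rewrite -[q in LHS](@reprK _ (Quotient.quot tens_null)).
rewrite -[q' in LHS](@reprK _ (Quotient.quot tens_null)) -raddfB.
by rewrite tens_liftE FB.
Qed.

End Lift.
End TensorProduct.

(* gmul is total; gmul g h is meaningful only when gdom g = gcod h, and no
   definition below depends on its other values. *)
Record groupoid (G : Type) := Groupoid {
  gmul : G -> G -> G;
  ginv : G -> G;
  gdom := fun g => gmul (ginv g) g;
  gcod := fun g => gmul g (ginv g);
  ginvK : forall g, ginv (ginv g) = g;
  gdom_mul : forall g h, gdom g = gcod h -> gdom (gmul g h) = gdom h;
  gcod_mul : forall g h, gdom g = gcod h -> gcod (gmul g h) = gcod g;
  gmulA : forall g h k, gdom g = gcod h -> gdom h = gcod k ->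
    gmul g (gmul h k) = gmul (gmul g h) k;
  gmul_dom : forall g, gmul g (gdom g) = g;
  gmul_cod : forall g, gmul (gcod g) g = g }.

Definition gunits (G : Type) (S : groupoid G) : set G := range (gdom S).

Section AmpleGroupoid.
Context (G : topologicalType) (S : groupoid G).

Definition homeomorphism_on (U V : set G) (f : G -> G) : Prop :=
  [/\ set_bij U V f, {within U, continuous f}
    & exists2 g : G -> G, {in U, cancel f g} & {within V, continuous g}].

Definition unit_open (V : set G) : Prop :=
  V `<=` gunits S /\ open (V : set (subspace (gunits S))).

Definition homeo_onto_unit_open (f : G -> G) (U : set G) : Prop :=
  exists2 V, unit_open V & homeomorphism_on U V f.

Definition open_bisection (U : set G) : Prop :=
  [/\ open U, homeo_onto_unit_open (gdom S) U
    & homeo_onto_unit_open (gcod S) U].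

Definition compact_open_bisection (U : set G) : Prop :=
  compact U /\ open_bisection U.

(* In subspace A the points outside A are isolated, so hausdorff_space
   (subspace A) says exactly that A is Hausdorff. *)
Record ample : Prop := {
  ample_inv_continuous : continuous (ginv S);
  ample_mul_continuous :
    {within [set p : G * G | gdom S p.1 = gcod S p.2],
      continuous (fun p : G * G => gmul S p.1 p.2)};
  ample_local_homeo : forall g, exists U,
    [/\ open U, U g & homeo_onto_unit_open (gdom S) U];
  ample_hausdorff : hausdorff_space (subspace (gunits S));
  ample_basis : basis compact_open_bisection }.

Record groupoid_grading (Gam : zmodType) (kappa : G -> Gam) : Prop := {
  grading_continuous : continuous (kappa : G -> discrete_topology Gam);
  grading_mul : forall g h, gdom S g = gcod S h ->
    kappa (gmul S g h) = kappa g + kappa h }.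

End AmpleGroupoid.

Section Steinberg.
Context (R : comPzRingType) (Gam : zmodType).
Context (G : topologicalType) (S : groupoid G) (kappa : G -> Gam).

Definition steinberg_span (P : set (set G)) : set (G -> R) :=
  addspan [set f | exists r U, [/\ compact_open_bisection S U, P U
    & f = (fun g => r * \1_U g)]].

Definition steinberg_pred : {pred G -> R} :=
  fun f => `[< steinberg_span setT f >].

Fact steinberg_zmod_closed : zmod_closed steinberg_pred.
Proof.
have [H0 HB] := addspan_subgroup [set f : G -> R | exists r U,
  [/\ compact_open_bisection S U, setT U & f = (fun g => r * \1_U g)]].
split=> [|u v]; rewrite !unfold_in; first exact/asboolP.
move=> /asboolP uH /asboolP vH; apply/asboolP; exact: HB.
Qed.

HB.instance Definition _ :=
  GRing.isZmodClosed.Build (G -> R) steinberg_pred steinberg_zmod_closed.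

Record steinberg := Steinberg {
  steinberg_fun :> G -> R;
  _ : steinberg_fun \in steinberg_pred }.

HB.instance Definition _ := [isSub for steinberg_fun].
HB.instance Definition _ := [Choice of steinberg by <:].
HB.instance Definition _ := [SubChoice_isSubZmodule of steinberg by <:].

Definition convolution (f h : G -> R) : G -> R := fun g =>
  \sum_(y \in [set y | gdom S y = gdom S g]) f (gmul S g (ginv S y)) * h y.

(* A_R(G) is closed under convolution (1_U * 1_V = 1_{UV}), so the default
   value 0 of insubd is never taken. *)
Definition steinberg_mul (f h : steinberg) : steinberg :=
  insubd 0 (convolution f h).

Definition steinberg_alg : gringData Gam := {|
  gr_car := steinberg;
  gr_mul := steinberg_mul;
  gr_comp := fun gam => [set f |
    steinberg_span [set U | U `<=` kappa @^-1` [set gam]] f] |}.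

End Steinberg.

Section Induction.
Context (R : comPzRingType) (Gam : zmodType).
Context (G : topologicalType) (S : groupoid G) (kappa : G -> Gam) (x : G).

Definition Lx := {t : G | gdom S t == x}.
Definition Gx := {h : G | (gdom S h == x) && (gcod S h == x)}.

Fact Lx_mul_subproof (t : Lx) (h : Gx) :
  gdom S (gmul S (val t) (val h)) == x.
Proof.
case: t h => [t tx] [h /andP[dx cx]] /=.
by rewrite gdom_mul ?(eqP tx) ?(eqP cx).
Qed.

Definition Lx_mul (t : Lx) (h : Gx) : Lx :=
  Sub (gmul S (val t) (val h)) (Lx_mul_subproof t h).

Fact Gx_mul_subproof (g h : Gx) :
  (gdom S (gmul S (val g) (val h)) == x) &&
  (gcod S (gmul S (val g) (val h)) == x).
Proof.
case: g h => [g /andP[gd gc]] [h /andP[hd hc]] /=.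
by rewrite gdom_mul ?gcod_mul ?(eqP gd) ?(eqP hc) // gc hd.
Qed.

Definition Gx_mul (g h : Gx) : Gx :=
  Sub (gmul S (val g) (val h)) (Gx_mul_subproof g h).

(* {malg R[K]} is the free R-module on K and <<r *g k>> is r times the basis
   element k. *)
Definition isotropy_ring : gringData Gam := {|
  gr_car := {malg R[Gx]};
  gr_mul := fun a b => \sum_(g <- msupp a) \sum_(h <- msupp b)
    << a@_g * b@_h *g Gx_mul g h >>;
  gr_comp := fun gam => addspan [set a | exists r (h : Gx),
    kappa (val h) = gam /\ a = << r *g h >>] |}.

Definition RLx : zmodType := {malg R[Lx]}.

Definition RLx_ract (u : RLx) (a : isotropy_ring) : RLx :=
  \sum_(t <- msupp u) \sum_(h <- msupp (a : {malg R[Gx]}))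
    << u@_t * a@_h *g Lx_mul t h >>.

(* The sum is over y with d(y) = c(t); then d(yt) = d(t) = x, so insubd never
   takes its default value. *)
Definition RLx_lact (f : steinberg R S) (u : RLx) : RLx :=
  \sum_(t <- msupp u) \sum_(y \in [set y | gdom S y = gcod S (val t)])
    << f y * u@_t *g insubd t (gmul S y (val t)) >>.

Definition Ind_tens (N : gmodData isotropy_ring) : zmodType :=
  tens RLx_ract (@gm_act _ _ N).

Definition pure (N : gmodData isotropy_ring) (u : RLx) (n : N) : Ind_tens N :=
  tmk RLx_ract (@gm_act _ _ N) u n.

Definition Ind_act (N : gmodData isotropy_ring) (f : steinberg R S)
    (q : Ind_tens N) : Ind_tens N :=
  tens_lift (fun u n => pure (RLx_lact f u) n) q.

Definition Ind_comp (N : gmodData isotropy_ring) (gam : Gam)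
  : set (Ind_tens N) :=
  addspan [set q | exists (r : R) (t : Lx) (n : N) alpha beta,
    [/\ kappa (val t) = alpha, gm_comp beta n, alpha + beta = gam
      & q = pure << r *g t >> n]].

Definition Ind (N : gmodData isotropy_ring)
  : gmodData (steinberg_alg R S kappa) :=
  @GModData Gam (steinberg_alg R S kappa) (Ind_tens N) (@Ind_act N)
    (@Ind_comp N).

Definition Ind_map (M N : gmodData isotropy_ring) (f : M -> N)
  : Ind M -> Ind N := fun q : Ind_tens M =>
  tens_lift (fun u m => pure u (f m)) q.

End Induction.

Arguments isotropy_ring R {Gam G} S kappa x.

(* Main.v *)
(* Every compact open bisection acts on L_x by t |-> u t with at most one u, so
   both the bimodule identities and the product of A_R(G) reduce to the case of
   characteristic functions, where 1_U * 1_V = 1_{UV}.  The left action then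
   descends to the tensor product.

   The grading of the tensor product comes from its projections: with p_b the
   projection of N onto N_b, the map
     r t (x) n |-> r t (x) p_{g - kappa t} n
   is balanced because p_d (h n) = h p_{d - kappa h} n for h in G_x; it is the
   identity on the component of degree g and kills all others, so
   decompositions are unique. *)

Require Import Defs.
From mathcomp Require Import all_boot all_algebra.
From mathcomp Require Import all_classical topology numfun.
From mathcomp Require Import finmap monalg ring_quotient.

Set Implicit Arguments.
Unset Strict Implicit.
Unset Printing Implicit Defensive.

Import GRing.Theory.
Local Open Scope classical_set_scope.
Local Open Scope ring_scope.
Local Open Scope quotient_scope.

(** * Groupoids and compact open bisections *)

(** The sums over a fibre of d that define the product of A_R(G) and its action on RL_x range over
    possibly infinite sets, and are read as 0 when infinitely many terms are nonzero. No additivity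
    is available until elements of A_R(G) are known to have finite support on every fibre;
    bisections provide this, since they meet a fibre at most once. From then on identities compare
    additive maps, whose equalizer is a subgroup, so they can be tested on the functions r 1_U, on
    multiples r t and on pure tensors. The topological obstacle is that G need not be Hausdorff.
    Compactness of UV therefore rests on the unit space: the pairs with d(u) = c(v) form a closed
    set because units can be separated. Moreover A_R(G) need not have a unit; unitality of the
    induced module comes from the functions 1_U, with U a compact open bisection containing c(t),
    which fix t. *)

Section GroupoidTheory.
Context (G : Type) (S : groupoid G).
Implicit Types g h k : G.

Lemma gdom_inv g : gdom S (ginv S g) = gcod S g.
Proof. by rewrite /gdom ginvK. Qed.

Lemma gcod_inv g : gcod S (ginv S g) = gdom S g.
Proof. by rewrite /gcod ginvK. Qed.

Lemma gdom_dom g : gdom S (gdom S g) = gdom S g.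
Proof. by rewrite {2}/gdom gdom_mul ?gdom_inv. Qed.

Lemma gcod_dom g : gcod S (gdom S g) = gdom S g.
Proof. by rewrite {2}/gdom gcod_mul ?gdom_inv// gcod_inv. Qed.

Lemma gdom_cod g : gdom S (gcod S g) = gcod S g.
Proof. by rewrite -(gdom_inv g) gdom_dom. Qed.

Lemma gmulK g h : gdom S g = gcod S h -> gmul S (gmul S g h) (ginv S h) = g.
Proof.
move=> gh; rewrite -gmulA ?gcod_inv//.
by rewrite -[gmul S h _]/(gcod S h) -gh gmul_dom.
Qed.

Lemma gmulVK g h : gdom S g = gdom S h -> gmul S (gmul S g (ginv S h)) h = g.
Proof.
move=> gh; rewrite -gmulA ?gcod_inv ?gdom_inv//.
by rewrite -[gmul S _ h]/(gdom S h) -gh gmul_dom.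
Qed.

Lemma gunits_dom g : gunits S (gdom S g).
Proof. by exists g. Qed.

Lemma gunits_cod g : gunits S (gcod S g).
Proof. by rewrite -gdom_inv; exact: gunits_dom. Qed.

Definition gset_mul (U V : set G) : set G :=
  [set g | exists u v, [/\ U u, V v, gdom S u = gcod S v & g = gmul S u v]].

Definition injective_on (f : G -> G) (U : set G) : Prop :=
  forall g h, U g -> U h -> f g = f h -> g = h.

(** The unit d(uv) = d(v) determines v, and then d(u) = c(v) determines u. *)
Lemma gset_mul_dom_inj U V : injective_on (gdom S) U ->
  injective_on (gdom S) V -> injective_on (gdom S) (gset_mul U V).
Proof.
move=> dU dV _ _ [u [v [Uu Vv uv ->]]] [u' [v' [Uu' Vv' uv' ->]]].
rewrite !gdom_mul// => /(dV _ _ Vv Vv') vv; rewrite -vv in uv' *.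
by rewrite (dU u u')// uv.
Qed.

Lemma gset_mul_cod_inj U V : injective_on (gcod S) U ->
  injective_on (gcod S) V -> injective_on (gcod S) (gset_mul U V).
Proof.
move=> dU dV _ _ [u [v [Uu Vv uv ->]]] [u' [v' [Uu' Vv' uv' ->]]].
rewrite !gcod_mul// => /(dU _ _ Uu Uu') vv; rewrite -vv in uv' *.
by rewrite (dV v v')// -uv.
Qed.

End GroupoidTheory.

(** * Topology of ample groupoids *)

Section AmpleTheory.
Context (G : topologicalType) (S : groupoid G) (hS : ample S).

(** Multiplication is continuous only on the subspace of composable pairs, so composability has to
    be assumed again for the nearby points. *)
Lemma gmul_nbhs (g h : G) (A : set G) :
  gdom S g = gcod S h -> nbhs (gmul S g h) A ->
  exists B C, [/\ nbhs g B, nbhs h C & forall g' h', B g' -> C h' ->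
    gdom S g' = gcod S h' -> A (gmul S g' h')].
Proof.
move=> gh Agh; have /subspace_continuousP /(_ (g, h) gh A Agh) :=
  ample_mul_continuous hS.
move=> -[[B C] [/= Bg Ch] BC]; exists B, C; split=> // g' h' Bg' Ch' gh'.
exact: (BC (g', h')).
Qed.

Lemma gdom_continuous : continuous (gdom S).
Proof.
move=> g A Ag; have [||B [C [Bg Cg BC]]] := @gmul_nbhs (ginv S g) g A.
- by rewrite gdom_inv.
- exact: Ag.
have {}Bg : nbhs g (ginv S @^-1` B) by exact: ample_inv_continuous Bg.
suff: nbhs g (gdom S @^-1` A) by [].
apply: (filterS _ (filterI Bg Cg)) => h [Bh Ch].
by apply: BC => //; rewrite gdom_inv.
Qed.

Lemma gcod_continuous : continuous (gcod S).
Proof.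
have -> : gcod S = gdom S \o ginv S by apply/funext => g; rewrite /= gdom_inv.
move=> g; apply: continuous_comp; first exact: ample_inv_continuous.
exact: gdom_continuous.
Qed.

(** Take U around a unit with d injective on U. If h and d(h) both lie in U, then d(d(h)) = d(h)
    forces h = d(h), so h is a unit; by continuity of d this covers a neighbourhood. *)
Lemma gunits_open : open (gunits S).
Proof.
rewrite openE => _ [g _ <-].
have [U [oU Ug [V _ [[_ dU _] _ _]]]] := ample_local_homeo hS (gdom S g).
have oW : open (U `&` gdom S @^-1` U).
  by apply: openI => //; apply: open_comp => // h _; exact: gdom_continuous.
have : nbhs (gdom S g) (U `&` gdom S @^-1` U).
  by apply: open_nbhs_nbhs; split=> //; split=> //=; rewrite gdom_dom.
apply: filterS => h [Uh /= Udh]; exists h => //.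
by apply: dU; [exact: mem_set|exact: mem_set|exact: gdom_dom].
Qed.

Lemma unit_openE (V : set G) : unit_open S V <-> V `<=` gunits S /\ open V.
Proof.
split=> -[VS oV]; split=> //; last exact: open_subspaceW.
move/open_subspaceP : oV => [W oW]; rewrite (setIidl VS) => <-.
by apply: openI => //; exact: gunits_open.
Qed.

(** The local inverse [e] of d sends units close to d(g) into W, so each of them is the image of a
    point of W. *)
Lemma gdom_open_map (W : set G) : open W -> open (gdom S @` W).
Proof.
move=> oW; rewrite openE => _ [g Wg <-].
have [U [oU Ug [V /unit_openE[_ oV] [[dUV _ dV] _ [e de ce]]]]] :=
  ample_local_homeo hS g.
have {}de u : U u -> e (gdom S u) = u by move=> /mem_set/de.
have Vg : V (gdom S g) by exact: dUV.
rewrite continuous_open_subspace// in ce.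
have {}ce := ce (gdom S g) (mem_set Vg).
have : nbhs (gdom S g) (V `&` e @^-1` W).
  apply: filterI; first by apply: open_nbhs_nbhs.
  by apply: ce; rewrite /= de//; apply: open_nbhs_nbhs.
apply: filterS => _ [/dV[u Uu <-]] /=; rewrite de ?inE// => Wu.
by exists u.
Qed.

(** Since d is continuous and open, injectivity on an open set already makes the inverse
    continuous. *)
Lemma gdom_homeo (W : set G) : open W -> injective_on (gdom S) W ->
  homeo_onto_unit_open S (gdom S) W.
Proof.
move=> oW dW; exists (gdom S @` W).
  apply/unit_openE; split; last exact: gdom_open_map.
  by move=> _ [g _ <-]; exact: gunits_dom.
(* The default value [v] is taken only off the image of W, where the inverse is not constrained. *)
pose e v := xget v [set g | W g /\ gdom S g = v].
have eE g : W g -> e (gdom S g) = g.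
  rewrite /e => Wg; case: xgetP => [h _ [Wh]|/(_ g)/=]; first exact: dW.
  by case.
split.
- split; [by move=> g Wg; exists g| |by []].
  by move=> g h /set_mem Wg /set_mem Wh; exact: dW.
- exact/continuous_subspaceT/gdom_continuous.
- exists e; first by move=> g /set_mem; exact: eE.
  rewrite continuous_open_subspace; last exact: gdom_open_map.
  move=> _ /set_mem[g Wg <-] A; rewrite eE// nbhsE => -[B [oB Bg] BA].
  have : nbhs (gdom S g) (gdom S @` (B `&` W)).
    apply: open_nbhs_nbhs; split; last by exists g.
    by apply: gdom_open_map; exact: openI.
  by apply: filterS => _ [h [Bh Wh] <-] /=; rewrite eE//; exact: BA.
Qed.

(** Inversion is a homeomorphism exchanging c and d, so the statement for d is applied to the
    preimage of W under inversion. *)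
Lemma gcod_homeo (W : set G) : open W -> injective_on (gcod S) W ->
  homeo_onto_unit_open S (gcod S) W.
Proof.
move=> oW cW.
have oW' : open (ginv S @^-1` W).
  by apply: open_comp => // g _; exact: ample_inv_continuous.
have dW' : injective_on (gdom S) (ginv S @^-1` W).
  move=> g h Wg Wh gh; rewrite -[g](ginvK S) -[h](ginvK S); congr ginv.
  by apply: cW => //; rewrite !gcod_inv.
have [V oV [[dV _ Vd] _ [e de ce]]] := gdom_homeo oW' dW'.
have dE g : gcod S g = gdom S (ginv S g) by rewrite gdom_inv.
exists V => //; split.
- split.
  + by move=> g Wg; rewrite dE; apply: dV; rewrite /= ginvK.
  + by move=> g h /set_mem Wg /set_mem Wh; exact: cW.
  + move=> _ /Vd[g Wg <-]; exists (ginv S g) => //.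
    by rewrite gcod_inv.
- exact/continuous_subspaceT/gcod_continuous.
- exists (ginv S \o e).
    move=> g /set_mem Wg.
    by rewrite /= dE de ?ginvK//; apply: mem_set; rewrite /= ginvK.
  have /unit_openE[_ oV'] := oV; rewrite !continuous_open_subspace// in ce *.
  move=> g Vg; apply: continuous_comp; first exact: ce.
  exact: ample_inv_continuous.
Qed.

(** Reduces the topological definition to openness and two injectivity conditions, which for a
    product of bisections are plain algebra. *)
Lemma open_bisectionE (U : set G) : open_bisection S U <->
  [/\ open U, injective_on (gdom S) U & injective_on (gcod S) U].
Proof.
split=> [[oU [V _ [[_ dU _] _ _]] [V' _ [[_ cU _] _ _]]]|[oU dU cU]]; split=> //.
- by move=> g h /mem_set Ug /mem_set Uh; exact: dU.
- by move=> g h /mem_set Ug /mem_set Uh; exact: cU.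
- exact: gdom_homeo.
- exact: gcod_homeo.
Qed.

(* Near [u v] the right factor of [g] is the [w] in [V] with [d w = d g], and
   [g w^-1] stays in [U] by continuity. *)
Lemma gset_mul_open (U V : set G) :
  open U -> open_bisection S V -> open (gset_mul S U V).
Proof.
move=> oU [oV [D /unit_openE[_ oD] [[dVD dV Dd] _ [e de ce]]] _].
rewrite openE => _ [u [v [Uu Vv uv ->]]]; rewrite /interior.
set g := gmul S u v.
have gv : gdom S g = gdom S v by rewrite gdom_mul.
have Dg : D (gdom S g) by rewrite gv; exact: dVD.
have {}de w : V w -> e (gdom S w) = w by move=> /mem_set/de.
have eg : e (gdom S g) = v by rewrite gv de.
rewrite continuous_open_subspace// in ce.
have {}ce := ce (gdom S g) (mem_set Dg).
have cie : {for g, continuous (fun h => ginv S (e (gdom S h)))}.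
  apply: (@continuous_comp _ _ _ (e \o gdom S) (ginv S)).
    by apply: continuous_comp => //; exact: gdom_continuous.
  exact: ample_inv_continuous.
have [||B [C [Bg Cv BC]]] := @gmul_nbhs g (ginv S v) U.
- by rewrite gcod_inv.
- by rewrite gmulK//; apply: open_nbhs_nbhs.
have Cg : nbhs g (fun h => C (ginv S (e (gdom S h)))).
  by apply: cie; rewrite eg.
have Dg' : nbhs g (gdom S @^-1` D).
  by apply: gdom_continuous; apply: open_nbhs_nbhs.
apply: (filterS _ (filterI Bg (filterI Cg Dg'))) => h [Bh [Ch /Dd[w Vw wh]]].
move: Ch; rewrite /= -wh de// => Cw.
exists (gmul S h (ginv S w)), w; split => //.
- by apply: BC => //; rewrite gcod_inv.
- by rewrite gdom_mul ?gcod_inv// gdom_inv.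
- by rewrite gmulVK.
Qed.

(** UV is the continuous image of the composable pairs in U x V. These are compact because
    composability is a closed condition, the two units d(u) and c(v) being compared in a Hausdorff
    space. *)
Lemma gset_mul_compact (U V : set G) :
  compact U -> compact V -> compact (gset_mul S U V).
Proof.
move=> cU cV.
pose P := [set p : G * G | gdom S p.1 = gcod S p.2].
have -> : gset_mul S U V = (fun p => gmul S p.1 p.2) @` (P `&` U `*` V).
  apply/seteqP; split=> [_ [u [v [Uu Vv uv ->]]]|_ [[u v] [/= uv [/= Uu Vv]] <-]].
    by exists (u, v).
  by exists u, v.
apply: continuous_compact.
  apply: continuous_subspaceW (ample_mul_continuous hS).
  by move=> p [].
rewrite setIC; apply: compact_closedI; first exact: compact_setX.
move=> [g h] gh.
apply: (ample_hausdorff hS) => A B.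
rewrite /nbhs/= -!nbhs_subspace_in /=; [|exact: gunits_cod|exact: gunits_dom].
rewrite !withinE => -[A' /gdom_continuous A'g AE] [B' /gcod_continuous B'h BE].
(* A composable pair close to (g, h) yields the unit d(g') = c(h') lying in both neighbourhoods, so
   d(g) and c(h) cannot be separated. *)
have [|[g' h'] [/= gh' [/= A'g' B'h']]] := gh (gdom S @^-1` A' `*` gcod S @^-1` B').
  by exists (gdom S @^-1` A', gcod S @^-1` B').
exists (gdom S g'); split.
  suff: (A `&` gunits S) (gdom S g') by case.
  by rewrite AE; split => //; exact: gunits_dom.
rewrite gh'; suff: (B `&` gunits S) (gcod S h') by case.
by rewrite BE; split => //; exact: gunits_cod.
Qed.

Lemma compact_open_bisection_mul (U V : set G) :
  compact_open_bisection S U -> compact_open_bisection S V ->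
  compact_open_bisection S (gset_mul S U V).
Proof.
move=> [cU bU] [cV bV]; split; first exact: gset_mul_compact.
have /open_bisectionE[oU dU kU] := bU; have /open_bisectionE[oV dV kV] := bV.
apply/open_bisectionE; split; first exact: gset_mul_open.
- exact: gset_mul_dom_inj.
- exact: gset_mul_cod_inj.
Qed.

Lemma compact_open_bisection_at (g : G) :
  exists2 U, compact_open_bisection S U & U g.
Proof.
have [_ /(_ g)] := ample_basis hS.
by move=> /(_ setT filterT)[U [bU Ug] _]; exists U.
Qed.

End AmpleTheory.

(** * Additive maps, free modules and tensor products *)

Section Subgroups.
Context (V : zmodType).
Implicit Types H S : set V.

Lemma subgroupN H v : is_subgroup H -> H v -> H (- v).
Proof. by move=> [H0 HB] Hv; rewrite -sub0r; exact: HB. Qed.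

Lemma subgroupD H u v : is_subgroup H -> H u -> H v -> H (u + v).
Proof.
by move=> HH Hu Hv; rewrite -[v]opprK; apply: HH.2 => //; exact: subgroupN.
Qed.

Lemma subgroup_sum H (I : Type) (s : seq I) (P : pred I) (F : I -> V) :
  is_subgroup H -> (forall i, P i -> H (F i)) -> H (\sum_(i <- s | P i) F i).
Proof.
move=> HH HF; apply: big_ind => //; first exact: HH.1.
by move=> u v; exact: subgroupD.
Qed.

Lemma addspan_sub H S : is_subgroup H -> S `<=` H -> addspan S `<=` H.
Proof. by move=> HH SH; exact: smallest_sub. Qed.

End Subgroups.

(** Additivity is phrased with subtraction to match [is_subgroup]: preimages of subgroups and
    equalizers are then subgroups by a single identity. *)
Definition submorph (U V : zmodType) (f : U -> V) : Prop :=
  {morph f : u v / u - v}.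

Section Submorph.
Context (U V : zmodType) (f : U -> V) (fB : submorph f).

Lemma submorph0 : f 0 = 0.
Proof. by rewrite -(subrr 0) fB subrr. Qed.

Lemma submorphN u : f (- u) = - f u.
Proof. by rewrite -[- u]sub0r fB submorph0 sub0r. Qed.

Lemma submorphD u v : f (u + v) = f u + f v.
Proof. by rewrite -[in LHS](opprK v) fB submorphN opprK. Qed.

Lemma submorph_sum (I : Type) (s : seq I) (F : I -> U) :
  f (\sum_(i <- s) F i) = \sum_(i <- s) f (F i).
Proof. exact: (big_morph f submorphD submorph0). Qed.

Lemma subgroup_preimage (H : set V) : is_subgroup H -> is_subgroup (f @^-1` H).
Proof.
move=> HH; split=> [|u v Hu Hv] /=; first by rewrite submorph0; exact: HH.1.
by rewrite fB; exact: HH.2.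
Qed.

End Submorph.

Lemma morphD_submorph (U V : zmodType) (f : U -> V) :
  {morph f : u v / u + v} -> submorph f.
Proof. by move=> fD u v; apply/eqP; rewrite eq_sym subr_eq -fD subrK. Qed.

Lemma submorph_comp (U V W : zmodType) (f : V -> W) (h : U -> V) :
  submorph f -> submorph h -> submorph (fun u => f (h u)).
Proof. by move=> fB hB u v; rewrite hB fB. Qed.

Lemma submorph_sub (U V : zmodType) (f h : U -> V) :
  submorph f -> submorph h -> submorph (fun u => f u - h u).
Proof. by move=> fB hB u v; rewrite fB hB !opprD addrACA. Qed.

(** The induction principle behind most later identities: two additive maps that agree on generators
    agree everywhere. *)
Lemma submorph_eq_subgroup (U V : zmodType) (f h : U -> V) :
  submorph f -> submorph h -> is_subgroup [set u | f u = h u].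
Proof.
move=> fB hB; split=> [|u v /= fu fv]; first by rewrite /= !submorph0.
by rewrite fB hB fu fv.
Qed.

Section FinitelySupportedSums.
Context (I : choiceType) (V : zmodType) (P : set I).
Implicit Types F : I -> V.

Lemma fsum_fset_set (D : set I) F : finite_set D -> D `<=` P ->
  (forall i, P i -> F i <> 0 -> D i) ->
  \sum_(i \in P) F i = \sum_(i <- fset_set D) F i.
Proof.
move=> finD DP FD; rewrite -fsbig_finite//; apply/esym/fsbig_widen => //.
by move=> i [Pi Di]; apply: contra_notP Di => Fi; exact: FD.
Qed.

(** A sum with infinite support is 0 by convention, so finiteness of both supports is a genuine
    condition; their union serves as a common index set for the three sums. *)
Lemma fsumB F F' : finite_set (P `&` [set i | F i <> 0]) ->
  finite_set (P `&` [set i | F' i <> 0]) ->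
  \sum_(i \in P) (F i - F' i) = \sum_(i \in P) F i - \sum_(i \in P) F' i.
Proof.
move=> finF finF'.
pose D := (P `&` [set i | F i <> 0]) `|` (P `&` [set i | F' i <> 0]).
have finD : finite_set D by rewrite finite_setU.
have DP : D `<=` P by move=> i [|] [].
rewrite !(@fsum_fset_set D)//; first by rewrite sumrB.
- by move=> i Pi Fi; right.
- by move=> i Pi Fi; left.
- move=> i Pi Fi; have [Fi0|] := pselect (F i = 0); last by left.
  by right; split=> // F'i0; apply: Fi; rewrite Fi0 F'i0 subrr.
Qed.

Lemma fsum_only F i : P i -> (forall j, P j -> F j <> 0 -> j = i) ->
  \sum_(j \in P) F j = F i.
Proof.
move=> Pi Fi; transitivity (\sum_(j \in [set i]) F j); last exact: fsbig_set1.
apply/esym/fsbig_widen.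
  by move=> _ ->.
by move=> j [Pj]; apply: contra_notP => /(Fi _ Pj).
Qed.

Lemma subgroup_fsum (H : set V) F :
  is_subgroup H -> (forall i, H (F i)) -> H (\sum_(i \in P) F i).
Proof. by move=> HH HF; apply: subgroup_sum. Qed.

End FinitelySupportedSums.

Section MalgExtension.
Context (K : choiceType) (A V : zmodType) (phi : K -> A -> V).

(** The shape to which both actions on RL_x unfold, so that their additivity and their values on
    basis elements are instances of the lemmas below. *)
Definition malg_ext (u : {malg A[K]}) : V := \sum_(k <- msupp u) phi k u@_k.

Hypothesis phiB : forall k, submorph (phi k).

Lemma malg_ext_fset (d : {fset K}) (u : {malg A[K]}) :
  (msupp u `<=` d)%fset -> malg_ext u = \sum_(k <- d) phi k u@_k.
Proof.
move=> ud; apply: big_fset_incl => // k _ uk.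
by rewrite mcoeff_outdom// submorph0.
Qed.

Lemma malg_extB : submorph malg_ext.
Proof.
move=> u v; pose d := (msupp u `|` msupp v `|` msupp (u - v))%fset.
rewrite !(@malg_ext_fset d) ?fsubsetUr//.
- by rewrite -sumrB; apply: eq_bigr => k _; rewrite mcoeffB phiB.
- by rewrite /d fsetUAC fsubsetUr.
- by rewrite /d -fsetUA fsubsetUl.
Qed.

Lemma malg_extU k r : malg_ext << r *g k >> = phi k r.
Proof. by rewrite (malg_ext_fset msuppU_le) big_seq_fset1 mcoeffUU. Qed.

End MalgExtension.

Lemma malg_subgroup (K : choiceType) (A : zmodType) (H : set {malg A[K]}) :
  is_subgroup H -> (forall r k, H << r *g k >>) -> forall u, H u.
Proof. by move=> HH HU u; rewrite [u]monalgE; exact: subgroup_sum. Qed.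

(** * Generators and universal property of the tensor product *)

Section TensorTheory.
Context (B U N : zmodType) (ract : U -> B -> U) (lact : B -> N -> N).
Local Notation tmk := (tmk ract lact).
Local Notation Q := (Quotient.quot (tens_null ract lact)).

Lemma tmk_relator z : tens_relators ract lact z -> \pi_Q z = 0 :> Q.
Proof.
move=> Rz; apply/eqP; rewrite -[0](raddf0 (\pi_Q)) -Quotient.idealrBE subr0.
by apply/asboolP; exact: sub_addspan.
Qed.

Lemma tmkBl n : submorph (tmk^~ n).
Proof.
apply: morphD_submorph => u u'; apply/eqP; rewrite -subr_eq0 opprD addrA.
rewrite /Defs.tmk -!raddfB; apply/eqP/tmk_relator; left; left.
by exists u, u', n.
Qed.

Lemma tmkBr u : submorph (tmk u).
Proof.
apply: morphD_submorph => n n'; apply/eqP; rewrite -subr_eq0 opprD addrA.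
rewrite /Defs.tmk -!raddfB; apply/eqP/tmk_relator; left; right.
by exists u, n, n'.
Qed.

Lemma tmk_balanced u b n : tmk (ract u b) n = tmk u (lact b n).
Proof.
apply/eqP; rewrite -subr_eq0 /Defs.tmk -raddfB; apply/eqP/tmk_relator; right.
by exists u, b, n.
Qed.

Lemma tens_subgroup (H : set (tens ract lact)) :
  is_subgroup H -> (forall u n, H (tmk u n)) -> forall q, H q.
Proof.
move=> HH Htmk q; rewrite -[q](@reprK _ Q); move: (repr _) => z.
apply: (@malg_subgroup _ _ [set z | H (\pi_Q z)]) => [|r [u n]] /=.
  by apply: (@subgroup_preimage _ _ (\pi_Q)) => // ? ?; rewrite raddfB.
(* The coefficient [r] is an integer, so the class is an integer multiple of one pure tensor and
   stays in any subgroup containing it. *)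
have -> : mkmalgU (u, n) r = mkmalgU (u, n) 1 *~ r.
  by rewrite -raddfMz /= intz.
rewrite raddfMz; have Hn k : H (tmk u n *+ k).
  by elim: k => [|k IH]; [exact: HH.1|rewrite mulrS; exact: subgroupD].
by case: r => k; [exact: Hn|apply: subgroupN => //; exact: Hn].
Qed.

Lemma tens_lift_submorph (T : zmodType) (f : U -> N -> T) :
  (forall n, submorph (f^~ n)) -> (forall u, submorph (f u)) ->
  (forall u b n, f (ract u b) n = f u (lact b n)) ->
  submorph (tens_lift f : tens ract lact -> T) /\
  forall u n, tens_lift f (tmk u n) = f u n.
Proof.
move=> fBl fBr fbal.
have fDl u u' n : f (u + u') n = f u n + f u' n by rewrite (submorphD (fBl n)).
have fDr u n n' : f u (n + n') = f u n + f u n' by rewrite (submorphD (fBr u)).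
split=> [q q'|u n]; first exact: tens_liftB.
exact: tens_lift_tmk.
Qed.

End TensorTheory.

(** * Direct sum decompositions and their projections *)

Section GradedDecomposition.
Context (Gam : choiceType) (M : zmodType) (comp : Gam -> set M).

Definition decomposition (m : M) (f : Gam -> M) : Prop :=
  [/\ forall g, comp g (f g), finite_set [set g | f g <> 0]
    & m = \sum_(g \in [set: Gam]) f g].

Record projections (p : Gam -> M -> M) : Prop := {
  projB : forall g, submorph (p g);
  proj_id : forall g m, comp g m -> p g m = m;
  proj_eq0 : forall g g' m, g <> g' -> comp g' m -> p g m = 0 }.

Hypothesis comp_subgroup : forall g, is_subgroup (comp g).

Lemma decomposition_subgroup : is_subgroup [set m | exists f, decomposition m f].
Proof.
split=> [|m n [f [fc ffin ->]] [h [hc hfin ->]]] /=.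
  exists (fun=> 0); split=> [g||]; first exact: (comp_subgroup g).1.
    by apply: (@sub_finite_set _ _ set0) => // g /=; apply.
  by rewrite fsbig1.
exists (fun g => f g - h g); split.
- by move=> g; apply: (comp_subgroup g).2.
- apply: (@sub_finite_set _ _ ([set g | f g <> 0] `|` [set g | h g <> 0])).
    move=> g /= fh; have [f0|] := pselect (f g = 0); last by left.
    by right=> h0; apply: fh; rewrite f0 h0 subrr.
  by rewrite finite_setU.
- by rewrite fsumB// setTI.
Qed.

Lemma decomposition_homogeneous g m : comp g m ->
  decomposition m (fun g' => if g' == g then m else 0).
Proof.
move=> mg; split.
- by move=> g'; case: eqP => [->//|_]; exact: (comp_subgroup g').1.
- apply: (@sub_finite_set _ _ [set g]) => // g' /=; by case: eqP.
- rewrite (@fsum_only _ _ _ _ g) ?eqxx// => g' _; by case: eqP.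
Qed.

Lemma decomposition_proj p m f : projections p -> decomposition m f ->
  f = p^~ m.
Proof.
move=> pP [fc ffin ->]; apply/funext => g.
rewrite (@fsum_fset_set _ _ _ [set g | f g <> 0])// (submorph_sum (projB pP g)).
rewrite -fsbig_finite// -[f g](proj_id pP (fc g)).
(* The sum is extended by zero terms to all degrees, so that the term of degree [g] belongs to the
   index set even when [f g] is 0. *)
apply/esym; rewrite (@fsbig_widen _ _ _ _ _ setT) //; last first.
  move=> g' /= [_ /contrapT] ->; exact: (submorph0 (projB pP g)).
apply: (fsum_only (i := g)) => // g' _ pg'.
apply: contrapT => gg'; apply: pg'; apply: (proj_eq0 pP) (fc g').
by move=> /esym.
Qed.

(** Existence holds on homogeneous elements and passes to the subgroup they generate; uniqueness
    holds because any decomposition is read off by [p]. *)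
Lemma projections_direct_sum p : projections p ->
  (forall H : set M, is_subgroup H -> (forall g, comp g `<=` H) ->
    forall m, H m) ->
  forall m, exists! f, decomposition m f.
Proof.
move=> pP gen m.
have [f fm] : exists f, decomposition m f.
  apply: (gen _ decomposition_subgroup) => g n ng.
  by exists (fun g' => if g' == g then n else 0); exact: decomposition_homogeneous.
exists f; split=> // f' f'm.
by rewrite (decomposition_proj pP fm) (decomposition_proj pP f'm).
Qed.

Hypothesis direct_sum : forall m, exists! f, decomposition m f.

Lemma homogeneous_subgroup (H : set M) :
  is_subgroup H -> (forall g, comp g `<=` H) -> forall m, H m.
Proof.
move=> HH Hc m; have [f [[fc _ ->] _]] := direct_sum m.
by apply: subgroup_fsum => // g; exact: Hc (fc g).
Qed.

(** Choice selects the decomposition of each element. Additivity follows from uniqueness, the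
    difference of two decompositions being a decomposition of the difference. *)
Lemma direct_sum_projections : exists p, projections p.
Proof.
have [q qP] := choice direct_sum.
have qE m f : decomposition m f -> q m = f by exact: (qP m).2.
exists (fun g m => q m g); split.
- move=> g m n.
  have [[mc mfin mE] _] := qP m; have [[nc nfin nE] _] := qP n.
  rewrite (qE (m - n) (fun g => q m g - q n g))//; split.
  + by move=> g'; apply: (comp_subgroup g').2.
  + apply: (@sub_finite_set _ _ ([set g | q m g <> 0] `|` [set g | q n g <> 0])).
      move=> g' /= fh; have [f0|] := pselect (q m g' = 0); last by left.
      by right=> h0; apply: fh; rewrite f0 h0 subrr.
    by rewrite finite_setU.
  + by rewrite fsumB ?setTI// -mE -nE.
- by move=> g m /decomposition_homogeneous/qE ->; rewrite eqxx.
- by move=> g g' m gg' /decomposition_homogeneous/qE ->; case: eqP.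
Qed.

End GradedDecomposition.

(** * The Steinberg algebra acting on RL_x *)

Section SteinbergAlgebra.
Context (R : comPzRingType) (G : topologicalType) (S : groupoid G).
Implicit Types (f h : G -> R) (U V : set G).

Definition scaled_indic (r : R) U : G -> R := fun g => r * \1_U g.

Lemma scaled_indic_in r U g : U g -> scaled_indic r U g = r.
Proof. by move=> /mem_set Ug; rewrite /scaled_indic indicE Ug mulr1. Qed.

Lemma scaled_indic_support r U g : scaled_indic r U g <> 0 -> U g.
Proof.
rewrite /scaled_indic indicE; case: (boolP (g \in U)) => [/set_mem//|_].
by rewrite mulr0.
Qed.

Lemma scaled_indic_notin r U g : ~ U g -> scaled_indic r U g = 0.
Proof. by move=> Ug; apply: contrapT => /scaled_indic_support. Qed.

(** Exactly what keeps the sums over fibres of d, in the product and in the left action, away from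
    the default value 0. *)
Definition fiber_finite f : Prop :=
  forall z, finite_set ([set y | gdom S y = z] `&` [set y | f y <> 0]).

Lemma fiber_finite_subgroup : is_subgroup (fiber_finite : set (G -> R)).
Proof.
split=> [z|f h ff hf z].
  by apply: (@sub_finite_set _ _ set0) => // y [_ /=]; apply.
apply: sub_finite_set (_ : finite_set (([set y | gdom S y = z] `&`
  [set y | f y <> 0]) `|` ([set y | gdom S y = z] `&` [set y | h y <> 0]))).
  move=> y [yz /= fh]; have [f0|] := pselect (f y = 0); last by left.
  by right; split=> // h0; apply: fh; rewrite !fctE f0 h0 subrr.
by rewrite finite_setU.
Qed.

Lemma scaled_indic_fiber_finite r U :
  injective_on (gdom S) U -> fiber_finite (scaled_indic r U).
Proof.
move=> dU z; have [[u [Uu uz]]|noU] := pselect (exists u, U u /\ gdom S u = z).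
  apply: (@sub_finite_set _ _ [set u]) => // y [/= yz /scaled_indic_support Uy].
  by apply: dU => //; rewrite yz.
apply: (@sub_finite_set _ _ set0) => // y [/= yz /scaled_indic_support Uy].
by apply: noU; exists y.
Qed.

Section Convolution.
Variable z : G.
Local Notation fiber := [set y | gdom S y = gdom S z].

(** The factor [h] is evaluated along the fibre over d(z) itself, so its finiteness there bounds the
    support of every summand. *)
Lemma convolutionBl f f' h : fiber_finite h ->
  convolution S (f - f') h z = convolution S f h z - convolution S f' h z.
Proof.
move=> hf; rewrite /convolution -fsumB; last first.
- apply: sub_finite_set (hf (gdom S z)) => y [yz /= fh]; split=> //= h0.
  by apply: fh; rewrite h0 mulr0.
- apply: sub_finite_set (hf (gdom S z)) => y [yz /= fh]; split=> //= h0.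
  by apply: fh; rewrite h0 mulr0.
by apply: eq_fsbigr => y _; rewrite !fctE mulrBl.
Qed.

Lemma convolutionBr f h h' : fiber_finite h -> fiber_finite h' ->
  convolution S f (h - h') z = convolution S f h z - convolution S f h' z.
Proof.
move=> hf hf'; rewrite /convolution -fsumB; last first.
- apply: sub_finite_set (hf' (gdom S z)) => y [yz /= fh]; split=> //= h0.
  by apply: fh; rewrite h0 mulr0.
- apply: sub_finite_set (hf (gdom S z)) => y [yz /= fh]; split=> //= h0.
  by apply: fh; rewrite h0 mulr0.
by apply: eq_fsbigr => y _; rewrite !fctE mulrBr.
Qed.

End Convolution.

(** At g = uv the only y in V with d(y) = d(g) is v, and then g v^-1 = u. Conversely a nonzero term
    writes g as (g y^-1) y in UV. *)
Lemma convolution_indic r s U V :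
  injective_on (gdom S) V ->
  convolution S (scaled_indic r U) (scaled_indic s V) =
  scaled_indic (r * s) (gset_mul S U V).
Proof.
move=> dV; apply/funext => g; rewrite /convolution.
have [[u [v [Uu Vv uv ->]]]|noUV] := pselect (gset_mul S U V g).
  rewrite (fsum_only (i := v)) /=; last first.
  - move=> y yg; rewrite gdom_mul// in yg => fh; apply: dV => //.
    by apply: (@scaled_indic_support s) => h0; apply: fh; rewrite h0 mulr0.
  - by rewrite gdom_mul.
  by rewrite gmulK// !scaled_indic_in//; exists u, v.
rewrite fsbig1 ?scaled_indic_notin// => y yg; apply: contrapT => fh.
apply: noUV; exists (gmul S g (ginv S y)), y; split.
- by apply: (@scaled_indic_support r) => h0; apply: fh; rewrite h0 mul0r.
- by apply: (@scaled_indic_support s) => h0; apply: fh; rewrite h0 mulr0.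
- by rewrite gdom_mul ?gcod_inv// gdom_inv.
- by rewrite gmulVK.
Qed.

Lemma steinberg_fun_submorph :
  submorph (fun a : steinberg R S => a : G -> R).
Proof. by []. Qed.

Lemma steinberg_inj (a b : steinberg R S) : (a : G -> R) = b -> a = b.
Proof. by move=> ab; apply: val_inj. Qed.

Lemma scaled_indic_steinberg r U : compact_open_bisection S U ->
  exists a : steinberg R S, a = scaled_indic r U :> (G -> R).
Proof.
move=> bU.
have aP : scaled_indic r U \in steinberg_pred S.
  by apply/asboolP; apply: sub_addspan; exists r, U.
by exists (Steinberg aP).
Qed.

Lemma steinberg_span_subgroup (P : set (set G)) (H : set (steinberg R S)) :
  is_subgroup H ->
  (forall (a : steinberg R S) r U, compact_open_bisection S U -> P U ->
    a = scaled_indic r U :> (G -> R) -> H a) ->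
  forall a : steinberg R S, steinberg_span S P a -> H a.
Proof.
(* The span lives among all functions and [H] in the subtype, so the induction runs on the image of
   [H]. *)
move=> HH HU a; pose H' := [set f : G -> R | exists2 b : steinberg R S, H b & f = b].
suff /[apply] : steinberg_span S P `<=` H'.
  by move=> -[b Hb /steinberg_inj ->].
apply: addspan_sub => [|f [r [U [bU PU ->]]]].
  split=> [|_ _ [b Hb ->] [c Hc ->]]; first by exists 0 => //; exact: HH.1.
  by exists (b - c) => //; exact: HH.2.
by have [b bE] := scaled_indic_steinberg r bU; exists b; [exact: HU bE|].
Qed.

Lemma steinberg_subgroup (H : set (steinberg R S)) : is_subgroup H ->
  (forall (a : steinberg R S) r U, compact_open_bisection S U ->
    a = scaled_indic r U :> (G -> R) -> H a) ->
  forall a, H a.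
Proof.
move=> HH HU a; apply: (steinberg_span_subgroup HH (P := setT)).
  by move=> b r U bU _; exact: HU.
by case: a => f fP; exact/asboolP.
Qed.

Hypothesis hS : ample S.

Lemma steinberg_fiber_finite (a : steinberg R S) : fiber_finite a.
Proof.
move: a; apply: steinberg_subgroup => [|a r U [_ /(open_bisectionE hS)[_ dU _]] /= ->].
  exact: (subgroup_preimage steinberg_fun_submorph fiber_finite_subgroup).
exact: scaled_indic_fiber_finite.
Qed.

Lemma steinberg_convolutionBl (b : steinberg R S) :
  submorph (fun a : steinberg R S => convolution S a b).
Proof.
by move=> a a'; apply/funext => g; exact/convolutionBl/steinberg_fiber_finite.
Qed.

Lemma steinberg_convolutionBr (a : steinberg R S) :
  submorph (fun b : steinberg R S => convolution S a b).
Proof.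
move=> b b'; apply/funext => g.
by apply: convolutionBr; exact: steinberg_fiber_finite.
Qed.

(** Closure under the product, which lets [insubd] be removed from [steinberg_mul]. Both arguments
    are reduced to multiples of characteristic functions by biadditivity. *)
Lemma convolution_steinberg (a b : steinberg R S) :
  convolution S a b \in steinberg_pred S.
Proof.
apply/asboolP; move: a; apply: steinberg_subgroup => [|a r U bU aE].
  apply: subgroup_preimage (steinberg_convolutionBl b) _ _.
  exact: addspan_subgroup.
move: b; apply: steinberg_subgroup => [|b s V bV bE].
  apply: subgroup_preimage (steinberg_convolutionBr a) _ _.
  exact: addspan_subgroup.
have [_ /(open_bisectionE hS)[_ dV _]] := bV.
rewrite aE bE convolution_indic//; apply: sub_addspan.
by exists (r * s), (gset_mul S U V); split=> //; exact: compact_open_bisection_mul.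
Qed.

Lemma steinberg_mulE (a b : steinberg R S) :
  steinberg_mul a b = convolution S a b :> (G -> R).
Proof. by rewrite /steinberg_mul insubdK//; exact: convolution_steinberg. Qed.

Lemma steinberg_mulBl (b : steinberg R S) : submorph ((@steinberg_mul R G S)^~ b).
Proof.
move=> a a'; apply: steinberg_inj; rewrite steinberg_mulE.
rewrite [RHS]steinberg_fun_submorph !steinberg_mulE.
exact: steinberg_convolutionBl.
Qed.

Lemma steinberg_mulBr (a : steinberg R S) : submorph (@steinberg_mul R G S a).
Proof.
move=> b b'; apply: steinberg_inj; rewrite steinberg_mulE.
rewrite [RHS]steinberg_fun_submorph !steinberg_mulE.
exact: steinberg_convolutionBr.
Qed.

Lemma steinberg_mul_indic (a b : steinberg R S) r s U V :
  compact_open_bisection S V ->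
  a = scaled_indic r U :> (G -> R) -> b = scaled_indic s V :> (G -> R) ->
  steinberg_mul a b = scaled_indic (r * s) (gset_mul S U V) :> (G -> R).
Proof.
move=> [_ /(open_bisectionE hS)[_ dV _]] aE bE.
by rewrite steinberg_mulE aE bE convolution_indic.
Qed.

End SteinbergAlgebra.

(** * The bimodule structure of RL_x *)

Section Bimodule.
Context (R : comPzRingType) (Gam : zmodType).
Context (G : topologicalType) (S : groupoid G) (kappa : G -> Gam) (x : G).
Hypothesis hS : ample S.
Local Notation Lx := (Lx S x).
Local Notation RLx := (RLx R S x).
Local Notation RGx := (isotropy_ring R S kappa x).
Implicit Types (a b : steinberg R S) (u : RLx) (t : Lx).

Definition lact_basis (f : G -> R) (t : Lx) (r : R) : RLx :=
  \sum_(y \in [set y | gdom S y = gcod S (val t)])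
    << f y * r *g insubd t (gmul S y (val t)) >>.

Lemma lact_basis_support (f : G -> R) t r y :
  << f y * r *g insubd t (gmul S y (val t)) >> <> 0 :> RLx -> f y <> 0.
Proof. by move=> nz f0; apply: nz; rewrite f0 mul0r monalgU0. Qed.

Lemma lact_basis_finite (f : G -> R) t r : fiber_finite S f ->
  finite_set ([set y | gdom S y = gcod S (val t)] `&`
    [set y | << f y * r *g insubd t (gmul S y (val t)) >> <> 0 :> RLx]).
Proof.
move=> /(_ (gcod S (val t))); apply: sub_finite_set.
by move=> y [yt /lact_basis_support fy].
Qed.

Lemma lact_basisBl (f h : G -> R) t r : fiber_finite S f -> fiber_finite S h ->
  lact_basis (f - h) t r = lact_basis f t r - lact_basis h t r.
Proof.
move=> ff hf; rewrite /lact_basis -fsumB; try exact: lact_basis_finite.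
by apply: eq_fsbigr => y _; rewrite !fctE mulrBl monalgUB.
Qed.

Lemma lact_basisBr (f : G -> R) t : fiber_finite S f -> submorph (lact_basis f t).
Proof.
move=> ff r s; rewrite /lact_basis -fsumB; try exact: lact_basis_finite.
by apply: eq_fsbigr => y _; rewrite mulrBr monalgUB.
Qed.

Lemma lactBl u : submorph ((@RLx_lact R G S x)^~ u).
Proof.
move=> a b; rewrite /RLx_lact -sumrB; apply: eq_bigr => t _.
by apply: lact_basisBl; exact: steinberg_fiber_finite.
Qed.

Lemma lactBr a : submorph (@RLx_lact R G S x a).
Proof.
exact: malg_extB (fun t => lact_basisBr t (steinberg_fiber_finite hS a)).
Qed.

Lemma lactU a t r : RLx_lact a << r *g t >> = lact_basis a t r.
Proof.
exact: malg_extU (fun t => lact_basisBr t (steinberg_fiber_finite hS a)) t r.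
Qed.

Lemma val_insubd_mul t g : gdom S g = gcod S (val t) ->
  val (insubd t (gmul S g (val t))) = gmul S g (val t).
Proof. by move=> gt; rewrite insubdK// unfold_in gdom_mul//; exact: valP t. Qed.

Lemma lact_indic a r U g t s : compact_open_bisection S U ->
  a = scaled_indic r U :> (G -> R) -> U g -> gdom S g = gcod S (val t) ->
  RLx_lact a << s *g t >> = << r * s *g insubd t (gmul S g (val t)) >>.
Proof.
move=> [_ /(open_bisectionE hS)[_ dU _]] aE Ug gt.
rewrite lactU /lact_basis aE (fsum_only (i := g))//.
  by rewrite scaled_indic_in.
move=> y /= yt /lact_basis_support /scaled_indic_support Uy.
by apply: dU => //; rewrite yt.
Qed.

Lemma lact_indic0 a r U t s : a = scaled_indic r U :> (G -> R) ->
  ~ (exists2 g, U g & gdom S g = gcod S (val t)) ->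
  RLx_lact a << s *g t >> = 0.
Proof.
move=> aE noU; rewrite lactU /lact_basis aE fsbig1// => y /= yt.
apply: contrapT => /lact_basis_support /scaled_indic_support Uy.
by apply: noU; exists y.
Qed.

Lemma lactA a b u : RLx_lact (steinberg_mul a b) u = RLx_lact a (RLx_lact b u).
Proof.
move: u; apply: malg_subgroup => [|q t].
  by apply: submorph_eq_subgroup (lactBr _) (submorph_comp (lactBr _) (lactBr _)).
move: a; apply: steinberg_subgroup => [|a r U bU aE].
  apply: (@submorph_eq_subgroup _ _
    (fun a => RLx_lact (steinberg_mul a b) << q *g t >>)
    (fun a => RLx_lact a (RLx_lact b << q *g t >>))).
    apply: (submorph_comp (@lactBl _) (steinberg_mulBl hS b)).
  exact: lactBl.
move: b; apply: steinberg_subgroup => [|b s V bV bE].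
  apply: (@submorph_eq_subgroup _ _
    (fun b => RLx_lact (steinberg_mul a b) << q *g t >>)
    (fun b => RLx_lact a (RLx_lact b << q *g t >>))).
    apply: (submorph_comp (@lactBl _) (steinberg_mulBr hS a)).
  apply: submorph_comp; [exact: lactBr|exact: lactBl].
have abE := steinberg_mul_indic hS bV aE bE.
have bUV := compact_open_bisection_mul hS bU bV.
have [[v Vv vt]|noV] := pselect (exists2 v, V v & gdom S v = gcod S (val t)).
- rewrite /= (lact_indic _ bV bE Vv vt).
  pose t' : Lx := insubd t (gmul S v (val t)).
  have t'E : val t' = gmul S v (val t) by exact: val_insubd_mul.
  have ct' : gcod S (val t') = gcod S v by rewrite t'E gcod_mul.
  have [[u Uu uv]|noU] := pselect (exists2 u, U u & gdom S u = gcod S (val t')).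
  + rewrite (lact_indic _ bU aE Uu uv) mulrA; rewrite ct' in uv.
    have UVg : gset_mul S U V (gmul S u v) by exists u, v.
    have gt : gdom S (gmul S u v) = gcod S (val t) by rewrite gdom_mul.
    rewrite (lact_indic _ bUV abE UVg gt); congr (<< _ *g _ >>).
    apply: val_inj; rewrite (val_insubd_mul gt) (val_insubd_mul (t := t')) ?ct'//.
    by rewrite t'E -gmulA.
  + rewrite (lact_indic0 _ aE noU) (lact_indic0 _ abE)//.
    (* If some u v' in UV were composable with t, then d(v') = c(t) = d(v) would give v' = v, and u
       would be composable with v t. *)
    move=> [_ [u [v' [Uu Vv' uv ->]]]]; rewrite gdom_mul// => v't.
    apply: noU; exists u; rewrite // ct' uv; congr gcod.
    by have [_ /(open_bisectionE hS)[_ dV _]] := bV; apply: dV; rewrite ?vt.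
- rewrite /= (lact_indic0 _ bE noV) (submorph0 (lactBr _)) (lact_indic0 _ abE)//.
  move=> [_ [u [v' [Uu Vv' uv ->]]]]; rewrite gdom_mul// => v't.
  by apply: noV; exists v'.
Qed.

Definition ract_basis (c : {malg R[Gx S x]}) (t : Lx) (r : R) : RLx :=
  \sum_(h <- msupp c) << r * c@_h *g Lx_mul t h >>.

Lemma ract_basisB c t : submorph (ract_basis c t).
Proof.
move=> r s; rewrite -sumrB; apply: eq_bigr => h _.
by rewrite mulrBl monalgUB.
Qed.

Lemma ractBl (c : RGx) : submorph ((@RLx_ract R Gam G S kappa x)^~ c).
Proof. exact: (malg_extB (@ract_basisB c)). Qed.

Lemma ractBr u : submorph (@RLx_ract R Gam G S kappa x u).
Proof.
(* Exchanging the two sums exhibits the right action as an extension from the basis in its second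
   argument too. *)
have -> : @RLx_ract R Gam G S kappa x u = malg_ext (fun h s =>
    \sum_(t <- msupp u) << u@_t * s *g Lx_mul t h >>).
  by apply/funext => c; rewrite /RLx_ract exchange_big.
apply: malg_extB => h r s; rewrite -sumrB; apply: eq_bigr => t _.
by rewrite mulrBr monalgUB.
Qed.

Lemma ractUU r t s (h : Gx S x) :
  RLx_ract (<< r *g t >> : RLx) (<< s *g h >> : RGx) = << r * s *g Lx_mul t h >>.
Proof.
rewrite /RLx_ract -/(malg_ext (ract_basis << s *g h >>) << r *g t >>).
rewrite malg_extU; last exact: ract_basisB.
rewrite /ract_basis -/(malg_ext (fun k q => << r * q *g Lx_mul t k >>) << s *g h >>).
by rewrite malg_extU// => k p q; rewrite mulrBr monalgUB.
Qed.

Lemma Lx_Gx_composable t (h : Gx S x) : gdom S (val t) = gcod S (val h).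
Proof. by case: t h => [t /eqP tx] [h /andP[_ /eqP hx]] /=; rewrite tx. Qed.

(** Since c(th) = c(t), the same element of U, if any, acts on t and on th, and the identity becomes
    associativity in G. *)
Lemma lact_ract a u (c : RGx) :
  RLx_lact a (RLx_ract u c) = RLx_ract (RLx_lact a u) c.
Proof.
move: u; apply: malg_subgroup => [|q t].
  exact: submorph_eq_subgroup (submorph_comp (lactBr a) (@ractBl c))
    (submorph_comp (@ractBl c) (lactBr a)).
move: c; apply: malg_subgroup => [|s h].
  exact: submorph_eq_subgroup (submorph_comp (lactBr a) (@ractBr _)) (@ractBr _).
move: a; apply: steinberg_subgroup => [|a r U bU aE].
  apply: (@submorph_eq_subgroup _ _
    (fun a => RLx_lact a (RLx_ract << q *g t >> (<< s *g h >> : RGx)))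
    (fun a => RLx_ract (RLx_lact a << q *g t >>) (<< s *g h >> : RGx))).
    exact: lactBl.
  exact: submorph_comp (@ractBl (<< s *g h >> : RGx)) (@lactBl _).
have th := Lx_Gx_composable t h.
have cth : gcod S (val (Lx_mul t h)) = gcod S (val t) by exact: gcod_mul.
rewrite /= ractUU.
have [[u Uu ut]|noU] := pselect (exists2 u, U u & gdom S u = gcod S (val t)).
- rewrite (lact_indic _ bU aE Uu ut) ractUU.
  have uth : gdom S u = gcod S (val (Lx_mul t h)) by rewrite cth.
  rewrite (lact_indic _ bU aE Uu uth) mulrA; congr (<< _ *g _ >>).
  by apply: val_inj; rewrite val_insubd_mul//= val_insubd_mul// gmulA.
- rewrite (lact_indic0 _ aE) ?cth// (lact_indic0 _ aE)//.
  by rewrite (submorph0 (ractBl _)).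
Qed.

End Bimodule.

(** * Induced modules *)

Section GradedModuleTheory.
Context (Gam : zmodType) (A : gringData Gam) (N : gmodData A).
Hypothesis gN : graded_module N.

Lemma graded_module_projections : exists p, projections (@gm_comp _ _ N) p.
Proof.
apply: direct_sum_projections; [exact: gm_comp_subgroup|exact: gm_direct_sum].
Qed.

Lemma gm_actBr (a : A) : submorph (@gm_act _ _ N a).
Proof. exact/morphD_submorph/gm_actDr. Qed.

Lemma projections_act p : projections (@gm_comp _ _ N) p ->
  forall d a g (n : N), gr_comp d a -> p g (gm_act a n) = gm_act a (p (g - d) n).
Proof.
move=> pP d a g n da; move: n.
apply: (homogeneous_subgroup (gm_direct_sum gN)) => [|b n nb] /=.
  exact: submorph_eq_subgroup (submorph_comp (projB pP g) (gm_actBr a))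
    (submorph_comp (gm_actBr a) (projB pP _)).
have abn := gm_act_comp gN da nb.
(* For n of degree b, both sides equal a n when g = d + b, and both vanish otherwise. *)
have [->|gdb] := eqVneq g (d + b).
  by rewrite (proj_id pP abn) (proj_id (g := _ - _) pP)// addrC addKr.
rewrite (proj_eq0 pP _ abn); last exact/eqP.
rewrite (proj_eq0 pP _ nb) ?(submorph0 (gm_actBr a))// => gd.
by case/eqP: gdb; rewrite -gd addrC subrK.
Qed.

End GradedModuleTheory.

Lemma graded_hom_id (Gam : zmodType) (A : gringData Gam) (N : gmodData A) :
  graded_hom (fun n : N => n).
Proof. by []. Qed.

Lemma graded_hom_comp (Gam : zmodType) (A : gringData Gam)
    (M N P : gmodData A) (f : M -> N) (h : N -> P) :
  graded_hom f -> graded_hom h -> graded_hom (fun m => h (f m)).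
Proof.
move=> [fD fa fc] [hD ha hc]; split=> [m n|a m|g m mg].
- by rewrite fD hD.
- by rewrite fa ha.
- exact/hc/fc.
Qed.

Section InducedModule.
Context (R : comPzRingType) (Gam : zmodType).
Context (G : topologicalType) (S : groupoid G) (kappa : G -> Gam) (x : G).
Hypotheses (hS : ample S) (hkappa : groupoid_grading S kappa).
Local Notation Lx := (Lx S x).
Local Notation RLx := (RLx R S x).
Local Notation RGx := (isotropy_ring R S kappa x).
Implicit Types (M N : gmodData RGx) (u : RLx) (t : Lx).

Lemma pureBl N (n : N) : submorph (fun u => pure u n).
Proof. exact: tmkBl. Qed.

Lemma pureBr N u : submorph (@pure _ _ _ _ _ _ N u).
Proof. exact: tmkBr. Qed.

Lemma pure_balanced N u (c : RGx) (n : N) :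
  pure (RLx_ract u c) n = pure u (gm_act c n).
Proof. exact: tmk_balanced. Qed.

Lemma pureU_submorph N t (n : N) : submorph (fun r => pure << r *g t >> n).
Proof.
by apply: submorph_comp (pureBl n) _ => r s; rewrite monalgUB.
Qed.

Lemma Ind_tens_subgroup N (H : set (Ind_tens N)) : is_subgroup H ->
  (forall r t (n : N), H (pure << r *g t >> n)) -> forall q, H q.
Proof.
move=> HH HU; apply: tens_subgroup => // u n; move: u.
apply: (@malg_subgroup _ _ (fun u => H (pure u n))) => [|r t]; last exact: HU.
exact: (subgroup_preimage (pureBl n)).
Qed.

Lemma Ind_act_lift N (a : steinberg R S) :
  submorph (@Ind_act _ _ _ _ _ _ N a) /\
  forall u (n : N), Ind_act a (pure u n) = pure (RLx_lact a u) n.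
Proof.
apply: (tens_lift_submorph (f := fun u n => @pure R Gam G S kappa x N (RLx_lact a u) n)).
- by move=> n; exact: submorph_comp (pureBl n) (lactBr hS a).
- by move=> u; exact: pureBr.
- by move=> u c n; rewrite (lact_ract hS); exact: pure_balanced.
Qed.

Lemma Ind_actBr N (a : steinberg R S) : submorph (@Ind_act _ _ _ _ _ _ N a).
Proof. by have [] := Ind_act_lift N a. Qed.

Lemma Ind_act_pure N (a : steinberg R S) u (n : N) :
  Ind_act a (pure u n) = pure (RLx_lact a u) n.
Proof. by have [_] := Ind_act_lift N a. Qed.

(** The lift gives additivity in q only. Additivity in the algebra element is tested on pure tensors
    by comparing two additive maps of q with a and b fixed. *)
Lemma Ind_actBl N (q : Ind_tens N) :
  submorph (fun a : steinberg R S => Ind_act a q).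
Proof.
move=> a b; move: q; apply: Ind_tens_subgroup => [|r t n].
  exact: submorph_eq_subgroup (Ind_actBr (a - b))
    (submorph_sub (Ind_actBr a) (Ind_actBr b)).
by rewrite /= !Ind_act_pure (lactBl hS) pureBl.
Qed.

Lemma Ind_actA N (a b : steinberg R S) (q : Ind_tens N) :
  Ind_act (steinberg_mul a b) q = Ind_act a (Ind_act b q).
Proof.
move: q; apply: Ind_tens_subgroup => [|r t n].
  exact: submorph_eq_subgroup (Ind_actBr _)
    (submorph_comp (Ind_actBr a) (Ind_actBr b)).
by rewrite /= !Ind_act_pure lactA.
Qed.

(** A local unit: with c(t) in U, the element of U acting on t is the unit c(t) itself. *)
Lemma lact_local_unit r t : exists a : steinberg R S,
  RLx_lact a << r *g t >> = << r *g t >>.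
Proof.
have [U bU Uc] := compact_open_bisection_at hS (gcod S (val t)).
have [a aE] := scaled_indic_steinberg (1 : R) bU; exists a.
have dc := gdom_cod S (val t).
rewrite (lact_indic hS _ bU aE Uc dc) mul1r; congr (<< _ *g _ >>).
by apply: val_inj; rewrite val_insubd_mul// gmul_cod.
Qed.

Lemma Ind_unital N :
  addspan [set q : Ind_tens N | exists (a : steinberg R S) q', q = Ind_act a q']
  = setT.
Proof.
apply/seteqP; split=> // q _; move: q.
apply: Ind_tens_subgroup => [|r t n]; first exact: addspan_subgroup.
have [a at_] := lact_local_unit r t.
by apply: sub_addspan; exists a, (pure << r *g t >> n); rewrite Ind_act_pure at_.
Qed.

Lemma pure_comp N r t b (n : N) g : gm_comp b n -> kappa (val t) + b = g ->
  Ind_comp g (pure << r *g t >> n).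
Proof.
by move=> nb tbg; apply: sub_addspan; exists r, t, n, (kappa (val t)), b.
Qed.

Lemma Ind_comp_sub N g (H : set (Ind_tens N)) : is_subgroup H ->
  (forall r t b (n : N), gm_comp b n -> kappa (val t) + b = g ->
    H (pure << r *g t >> n)) ->
  @Ind_comp _ _ _ _ _ _ N g `<=` H.
Proof.
move=> HH Hpure; apply: addspan_sub => // _ [r [t [n [_ [b [<- nb gE ->]]]]]].
exact: Hpure gE.
Qed.

(** On generators, the u in U that acts on t has degree d, so u t has degree d + kappa(t). *)
Lemma Ind_act_comp N d g (a : steinberg R S) (q : Ind_tens N) :
  gr_comp (d : Gam) (a : steinberg_alg R S kappa) -> Ind_comp g q ->
  Ind_comp (d + g) (Ind_act a q).
Proof.
move=> da; move: q; apply: Ind_comp_sub => [|r t b n nb tbg].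
  by apply: (subgroup_preimage (Ind_actBr a)); exact: addspan_subgroup.
move: a da; apply: steinberg_span_subgroup => [|a s U bU Ud aE].
  apply: (subgroup_preimage (@Ind_actBl N (pure << r *g t >> n))).
  exact: addspan_subgroup.
rewrite /= Ind_act_pure.
have [[u Uu ut]|noU] := pselect (exists2 u, U u & gdom S u = gcod S (val t)).
  rewrite (lact_indic hS _ bU aE Uu ut); apply: pure_comp nb _.
  by rewrite val_insubd_mul// (grading_mul hkappa)// (Ud u Uu) -addrA tbg.
rewrite (lact_indic0 hS _ aE noU) (submorph0 (pureBl n)).
exact: (addspan_subgroup _).1.
Qed.

(** * Projections of the induced module onto its components *)

Section Projections.
Context (N : gmodData RGx) (gN : graded_module N).
Context (p : Gam -> N -> N) (pP : projections (@gm_comp _ _ N) p).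

Definition Ind_proj (g : Gam) : Ind_tens N -> Ind_tens N :=
  tens_lift (fun u n => malg_ext
    (fun t r => pure << r *g t >> (p (g - kappa (val t)) n)) u).

Lemma Ind_proj_lift g : submorph (Ind_proj g) /\
  forall u (n : N), Ind_proj g (pure u n) = malg_ext
    (fun t r => pure << r *g t >> (p (g - kappa (val t)) n)) u.
Proof.
have phiB n t : submorph (fun r => pure << r *g t >> (p (g - kappa (val t)) n)).
  exact: pureU_submorph.
have fBr u : submorph (fun n => malg_ext
    (fun t r => pure << r *g t >> (p (g - kappa (val t)) n)) u).
  move=> n n'; rewrite /malg_ext -sumrB; apply: eq_bigr => t _.
  by rewrite (projB pP) pureBr.
apply: tens_lift_submorph; [by move=> n; exact: malg_extB|exact: fBr|].
move=> u c n; move: u; apply: malg_subgroup => [|r t].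
  exact: submorph_eq_subgroup
    (submorph_comp (malg_extB (phiB n)) (@ractBl R Gam G S kappa x c))
    (malg_extB (phiB (gm_act c n))).
move: c; apply: malg_subgroup => [|s h].
  apply: (@submorph_eq_subgroup _ _ (fun c : RGx => malg_ext
    (fun t r => pure << r *g t >> (p (g - kappa (val t)) n))
    (RLx_ract << r *g t >> c)) (fun c : RGx => malg_ext (fun t r =>
    pure << r *g t >> (p (g - kappa (val t)) (gm_act c n))) << r *g t >>)).
    exact: submorph_comp (malg_extB (phiB n)) (@ractBr _ _ _ _ _ _ _).
  apply: (submorph_comp (fBr _)).
  by apply: morphD_submorph => c c'; rewrite (gm_actDl gN).
have rthE := @ractUU R Gam G S kappa x r t s h.
have lhsE := malg_extU (phiB n) (Lx_mul t h) (r * s).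
have rhsE := malg_extU (phiB (gm_act (<< s *g h >> : RGx) n)) t r.
(* Reading rs (th) as (rt)(sh) moves sh across the tensor sign. What remains is an equality in N,
   which follows from kappa(th) = kappa(t) + kappa(h). *)
rewrite -rthE pure_balanced in lhsE.
apply: etrans lhsE (etrans _ (esym rhsE)); congr pure.
have th := Lx_Gx_composable t h.
have sh : gr_comp (kappa (val h)) (<< s *g h >> : RGx).
  by apply: sub_addspan; exists s, h.
rewrite (projections_act gN pP _ _ sh) (grading_mul hkappa)//.
by rewrite opprD addrA.
Qed.

Lemma Ind_projU g r t (n : N) :
  Ind_proj g (pure << r *g t >> n) = pure << r *g t >> (p (g - kappa (val t)) n).
Proof. by rewrite (Ind_proj_lift g).2 malg_extU// => t'; exact: pureU_submorph. Qed.

Lemma Ind_proj_projections : projections (@Ind_comp _ _ _ _ _ _ N) Ind_proj.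
Proof.
have IB g : submorph (Ind_proj g) by exact: (Ind_proj_lift g).1.
split=> // [g|g g' q gg'].
  apply: Ind_comp_sub => [|r t b n nb tbg].
    exact: (submorph_eq_subgroup (h := id)).
  by rewrite /= Ind_projU (proj_id pP)// -tbg addrC addKr.
move: q; apply: Ind_comp_sub => [|r t b n nb tbg].
  apply: (submorph_eq_subgroup (h := fun=> 0)) => // u v.
  by rewrite subr0.
rewrite /= Ind_projU (proj_eq0 pP _ nb) ?(submorph0 (@pureBr _ _))// => gt.
by apply: gg'; rewrite -tbg -gt addrC subrK.
Qed.

End Projections.

Lemma Ind_graded_module N : graded_module N -> graded_module (Ind N).
Proof.
move=> gN; split.
- by move=> a b q; apply: (submorphD (@Ind_actBl N q)).
- by move=> a; apply: (submorphD (@Ind_actBr N a)).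
- exact: Ind_actA.
- exact: Ind_unital.
- by move=> g; exact: addspan_subgroup.
- have [p pP] := graded_module_projections gN.
  apply: projections_direct_sum (Ind_proj_projections gN pP) _.
    by move=> g; exact: addspan_subgroup.
  (* The components generate: in r t (x) n, split n into homogeneous parts; t is homogeneous
     already. *)
  move=> H HH Hc; apply: Ind_tens_subgroup => // r t n; move: n.
  apply: (homogeneous_subgroup (gm_direct_sum gN)) => [|b n nb].
    exact: (subgroup_preimage (pureBr << r *g t >>)).
  by apply: (Hc (kappa (val t) + b)); exact: pure_comp nb _.
- by move=> d g a q; exact: Ind_act_comp.
Qed.

(** * Induced maps, functoriality and shifts *)

Section InducedMap.
Context (M N : gmodData RGx) (f : M -> N) (hf : graded_hom f).

Lemma Ind_map_lift : submorph (Ind_map f : Ind_tens M -> Ind_tens N) /\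
  forall u (m : M), Ind_map f (pure u m) = pure u (f m).
Proof.
apply: (tens_lift_submorph (f := fun u m => @pure R Gam G S kappa x N u (f m))).
- by move=> m; exact: pureBl.
- move=> u; apply: submorph_comp (@pureBr N u) _.
  exact/morphD_submorph/(ghomD hf).
- by move=> u b n; rewrite (ghom_act hf) pure_balanced.
Qed.

Lemma Ind_map_graded_hom : graded_hom (Ind_map f).
Proof.
have [fB fpure] := Ind_map_lift; split.
- exact: (submorphD fB).
- move=> a; apply: Ind_tens_subgroup => [|r t n].
    exact: submorph_eq_subgroup (submorph_comp fB (@Ind_actBr M a))
      (submorph_comp (@Ind_actBr N a) fB).
  (* Both sides are equal to (a (r t)) (x) f n. *)
  apply: etrans (congr1 (Ind_map f) (Ind_act_pure a << r *g t >> n)) _.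
  apply: etrans (fpure _ _) _.
  apply: etrans _ (esym (congr1 (Ind_act a) (fpure << r *g t >> n))).
  exact: esym (Ind_act_pure _ _ _).
- move=> g; apply: Ind_comp_sub => [|r t b n nb tbg].
    by apply: (subgroup_preimage fB); exact: addspan_subgroup.
  by rewrite /= fpure; apply: pure_comp tbg; exact: ghom_comp nb.
Qed.

End InducedMap.

Lemma Ind_graded_functor : graded_functor (@Ind_map R Gam G S kappa x).
Proof.
split.
- exact: Ind_graded_module.
- by move=> M N f _ _; exact: Ind_map_graded_hom.
- move=> M _; have [iB ipure] := Ind_map_lift (graded_hom_id M).
  apply/funext; apply: Ind_tens_subgroup => [|r t n]; last exact: ipure.
  exact: (submorph_eq_subgroup (h := id)).
- move=> M N P f h _ _ _ hf hh.
  have [fB fpure] := Ind_map_lift hf; have [hB hpure] := Ind_map_lift hh.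
  have [cB cpure] := Ind_map_lift (graded_hom_comp hf hh).
  apply/funext; apply: Ind_tens_subgroup => [|r t n].
    exact: submorph_eq_subgroup cB (submorph_comp hB fB).
  by rewrite /= cpure fpure hpure.
Qed.

(** The tensor product and the action ignore the grading of N, so the two records share carrier and
    action, and equality, rather than an isomorphism, comes down to comparing components. *)
Lemma Ind_shift alpha N : Ind (shift alpha N) = shift alpha (Ind N).
Proof.
congr (@GModData _ (steinberg_alg R S kappa) (Ind_tens N) (@Ind_act _ _ _ _ _ _ N) _).
apply/funext => g; apply/seteqP; split.
- apply: (@Ind_comp_sub (shift alpha N) g); first exact: addspan_subgroup.
  move=> r t b n nb <-.
  exact: (@pure_comp N r t (b + alpha) n _ nb (addrA _ _ _)).
- apply: (@Ind_comp_sub N (g + alpha)); first exact: addspan_subgroup.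
  (* An element of degree b in N has degree b - alpha in the shifted module. *)
  move=> r t b n nb tbg; apply: (@pure_comp (shift alpha N) r t (b - alpha)).
    by rewrite /= subrK.
  by rewrite addrA tbg addrK.
Qed.

End InducedModule.

Theorem proposition3p3 (R : comPzRingType) (Gam : zmodType)
    (G : topologicalType) (S : groupoid G) (hS : ample S)
    (kappa : G -> Gam) (hkappa : groupoid_grading S kappa)
    (x : G) (hx : gunits S x) :
  [/\ (* Ind_x N is a graded A_R(G)-module, with a (u (x) n) = (a u) (x) n *)
      forall N : gmodData (isotropy_ring R S kappa x), graded_module N ->
        graded_module (Ind N) /\
        forall (a : steinberg_alg R S kappa) (u : RLx R S x) (n : N),
          gm_act a (pure u n : Ind N) = pure (RLx_lact a u) n,
      (* Ind_x is a functor, with (Ind_x f) (u (x) n) = u (x) f n *)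
      graded_functor (@Ind_map R Gam G S kappa x) /\
        (forall (M N : gmodData (isotropy_ring R S kappa x)) (f : M -> N),
          graded_module M -> graded_module N -> graded_hom f ->
          forall (u : RLx R S x) (m : M),
            Ind_map f (pure u m : Ind M) = pure u (f m))
    & (* Ind_x o T_alpha = T_alpha o Ind_x, on objects and on morphisms *)
      forall alpha : Gam,
        (forall N : gmodData (isotropy_ring R S kappa x), graded_module N ->
          Ind (shift alpha N) = shift alpha (Ind N)) /\
        (forall (M N : gmodData (isotropy_ring R S kappa x)) (f : M -> N),
          graded_module M -> graded_module N -> graded_hom f ->
          Ind_map (shift_map alpha f) = shift_map alpha (Ind_map f)
            :> (shift alpha (Ind M) -> shift alpha (Ind N)))].
Proof.
split.
- move=> N gN; split; first exact: Ind_graded_module.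
  by move=> a u n; exact: Ind_act_pure.
- split; first exact: Ind_graded_functor.
  by move=> M N f _ _ hf; have [] := Ind_map_lift hf.
- move=> alpha; split; first by move=> N _; exact: Ind_shift.
  (* A shift leaves underlying maps unchanged, and [Ind_map] does not refer to degrees. *)
  by [].
Qed.
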